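(* Let $p\ge 3$ be a prime and let $\alpha,\beta\ge 1$ be integers. (i) If $\bar a_{2\alpha}(4p)\equiv 0\pmod 2$, then for all integers $n,k\ge 0$ with $p\nmid(2n+1)$, $$\bar a_{2\alpha}\left(8p^{2k+1}n+4p^{2k+1}\right)\equiv 0\pmod 8.$$ (ii) If $\bar a_{2\beta+1}(4p)\equiv 0\pmod 2$, then for all integers $n,k\ge 0$ with $p\nmid(2n+1)$, $$\bar a_{2\beta+1}\left(8p^{2k+1}n+4p^{2k+1}\right)\equiv 0\pmod 4.$$
   Context: For integers $\ell\ge1$ write $f_\ell=\prod_{j\ge 1}(1-q^{\ell j})$. For a positive integer $s$, $\bar a_s(n)$ denotes the number of partitions of $n$ in which each odd part occurs in one of $s$ colors and the first occurrence of each part (parts of the same size but different colors being distinct) may be overlined. Equivalently, $$\sum_{n\ge0}\bar a_s(n)q^n=\frac{f_2^{3s-2}}{f_1^{2s}f_4^{s-1}}.$$ *)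

(* Defs.v *)
From HB Require Import structures.
From mathcomp Require Import all_boot.
Set Implicit Arguments.
Unset Strict Implicit.
Unset Printing Implicit Defensive.

(* There are no parts of size 0. *)
Definition ncolors (s j : nat) : nat :=
  if j == 0 then 0 else if odd j then s else 1.

(* A part of a partition of n is a size j <= n together with a color. *)
Definition cpart (s n : nat) := {j : 'I_n.+1 & 'I_(ncolors s j)}.

Definition part_size (s n : nat) (u : cpart s n) : nat := tag u.

(* A partition is encoded by the multiplicity of each colored part (at most n,
   since parts are positive) and the set of those colored parts whose first
   occurrence is overlined; only parts that do occur can be overlined. *)
Definition is_overpartition (s n : nat)
    (m : {ffun cpart s n -> 'I_n.+1}) (O : {set cpart s n}) : bool :=
  (\sum_(u : cpart s n) m u * part_size u == n) && [forall u in O, 0 < m u].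

Definition abar (s n : nat) : nat :=
  #|[set mO : {ffun cpart s n -> 'I_n.+1} * {set cpart s n}
      | is_overpartition mO.1 mO.2]|.

(* Main.v *)
Require Import Defs.
From mathcomp Require Import all_boot.
From mathcomp Require Import all_algebra qpoly ring zify.
Set Implicit Arguments.
Unset Strict Implicit.
Unset Printing Implicit Defensive.

(* Let [phi(q) = sum of q^(n^2) over all integers n].  By Gauss's identity
   [phi(-q) = prod (1 - q^j) / (1 + q^j)], the generating function of [abar s]
   is [phi(-q)^(-s) phi(-q^2)^(s - 1)].  Write [phi(-q) = 1 + 2 S(q)].  Then
   [phi(-q)^2 = 1] modulo 4, and [phi(-q)^2 = 1 + 4 (S(q) + S(q^2))] and
   [phi(-q)^4 = 1] modulo 8, because [S(q)^2 = S(q^2)] modulo 2.  So the series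
   is [1 + 2 S(q)] modulo 4 for odd [s], while for even [s] it is, modulo 8, a
   combination of [1], [4 S(q)], [2 S(q^2)] and [4 S(q^4)].  The exponents in
   the theorem have odd [p]-adic valuation, hence are not of the form [d t^2]
   with [d] in [{1, 2, 4}].
   Power series are truncated by evaluating at an element [x] of a commutative
   ring with [x^(N+1) = 0], namely the class of ['X] in [R['X] / ('X^(N+1))]. *)

Section OverpartitionSeries.
Import GRing.Theory.
Local Open Scope ring_scope.

(** * Gauss's identity in finite form *)

Definition signed_square_sum (A : comNzRingType) (x : A) (n : nat) : A :=
  \sum_(0 <= s < n) (-1) ^+ s.+1 * x ^+ (s.+1 ^ 2).

Definition partial_theta (A : comNzRingType) (x : A) (n : nat) : A :=
  1 + 2 * signed_square_sum x n.

(* A finite form of Gauss's identity [phi(-q) = prod (1 - q^j) / (1 + q^j)],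
   in the style of Shanks; the step from [n] to [n + 1] telescopes in [s]. *)
Lemma partial_theta_prod (A : comNzRingType) (x : A) n :
  \prod_(0 <= j < n) (1 + x ^+ j.+1) * partial_theta x n =
  \prod_(0 <= j < n) (1 - x ^+ j.+1) +
  2 * \sum_(0 <= s < n) (-1) ^+ s.+1 * x ^+ (s.+1 * n.+1) *
        (\prod_(s.+1 <= j < n) (1 - x ^+ j.+1) *
         \prod_(0 <= j < s) (1 + x ^+ j.+1)).
Proof.
pose D k := \prod_(0 <= j < k) (1 + x ^+ j.+1).
pose E k m := \prod_(k <= j < m) (1 - x ^+ j.+1).
pose U m k := \sum_(0 <= s < k)
  (-1) ^+ s.+1 * x ^+ (s.+1 * m.+1) * (E s.+1 m * D s).
rewrite -/(D n) -/(E 0 n) -/(U n n).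
elim: n => [|n IHn].
  by rewrite /D /E /U /partial_theta /signed_square_sum !big_geq // mulr0 !addr0 mulr1.
have DS k : D k.+1 = D k * (1 + x ^+ k.+1) by rewrite /D big_nat_recr.
have ES k m : (k <= m)%N -> E k m.+1 = E k m * (1 - x ^+ m.+1).
  by move=> km; rewrite /E big_nat_recr.
have D0 : D 0 = 1 by rewrite /D big_geq.
have En k : E k k = 1 by rewrite /E big_geq.
(* Up to sign, [h] is a discrete antiderivative of the summand of [U n.+1 - (1 + x ^+ n.+1) * U n],
   so only its two end values survive. *)
pose h s := (-1) ^+ s * x ^+ (s.+1 * n.+1) * (E s n * D s).
have tel : \sum_(0 <= s < n)
    ((-1) ^+ s.+1 * x ^+ (s.+1 * n.+2) * (E s.+1 n.+1 * D s)
     - (1 + x ^+ n.+1) *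
       ((-1) ^+ s.+1 * x ^+ (s.+1 * n.+1) * (E s.+1 n * D s)))
    = - h n - - h 0.
  apply: (@telescope_sumr_eq _ 0 n (fun s => - h s)) => // s /andP[_ sn].
  rewrite /h DS ES // (_ : E s n = (1 - x ^+ s.+1) * E s.+1 n); last first.
    by rewrite /E big_ltn.
  have -> : (s.+1 * n.+2 = s.+1 * n.+1 + s.+1)%N by lia.
  have -> : (s.+2 * n.+1 = s.+1 * n.+1 + n.+1)%N by lia.
  rewrite !exprD exprS; ring.
(* [h 0] gives the term with [E 0 n]; [- h n] and the new summand [s = n] merge into the multiple of
   [D n.+1], which matches the new term of theta. *)
have step : U n.+1 n.+1 = (1 + x ^+ n.+1) * U n n + x ^+ n.+1 * E 0 n
    + (-1) ^+ n.+1 * x ^+ (n.+1 ^ 2) * D n.+1.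
  rewrite {1}/U big_nat_recr //= -(subrK ((1 + x ^+ n.+1) * U n n) (\sum_(_ <= _ < n) _)).
  rewrite {1}/U mulr_sumr -sumrB tel /h DS D0 !En.
  rewrite -[(n.+1 ^ 2)%N]/(n.+1 * n.+1)%N.
  have -> : (n.+1 * n.+2 = n.+1 * n.+1 + n.+1)%N by lia.
  rewrite !mul1n !exprD (exprS (-1)) expr0; ring.
have thetaS : partial_theta x n.+1 =
    partial_theta x n + 2 * ((-1) ^+ n.+1 * x ^+ (n.+1 ^ 2)).
  by rewrite /partial_theta /signed_square_sum big_nat_recr //= mulrDr addrA.
rewrite thetaS mulrDr {1}DS mulrAC IHn step ES //; ring.
Qed.

(** * The generating series as powers of theta *)

(** Truncation of [(1 + y) / (1 - y)], the factor of one colored part: a positive multiplicity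
    counts twice, with and without overline. *)
Definition overpart_series (A : comNzRingType) (m : nat) (y : A) : A :=
  \sum_(i < m.+1) (2 ^ (0 < i))%:R * y ^+ i.

Lemma overpart_series_nilp (A : comNzRingType) (m : nat) (y : A) :
  y ^+ m.+1 = 0 -> (1 - y) * overpart_series m y = 1 + y.
Proof.
move=> y0; rewrite /overpart_series big_ord_recl !expr0 !mulr1.
under eq_bigr => i _ do rewrite lift0 expn1.
rewrite -mulr_sumr.
have := subrX1 y m.+1; rewrite y0 sub0r big_ord_recl expr0 => /eqP.
under eq_bigr => i _ do rewrite lift0.
set S := \sum_(_ < _) _ => /eqP yS.
have -> : (1 - y) * (1%:R + 2 * S) = - ((y - 1) * (1 + S)) *+ 2 - 1 + y by ring.
by rewrite -yS; ring.
Qed.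

Lemma add1_nilp_inv (A : comNzRingType) (m : nat) (y : A) :
  y ^+ m = 0 -> exists z, (1 + y) * z = 1.
Proof.
move=> y0; exists (\sum_(i < m) (- y) ^+ i).
by rewrite -[1 + y]opprK opprD addrC mulNr -subrX1 exprNn y0 mulr0 sub0r opprK.
Qed.

(** The error terms of [partial_theta_prod] contain [x ^+ (s.+1 * n.+1)] and vanish. The product of
    the [1 + x ^+ j.+1] is a unit, since each [x ^+ j.+1] is nilpotent, and can be cancelled. *)
Lemma prod_overpart_theta (A : comNzRingType) (x : A) (n m : nat) :
  (n <= m)%N -> x ^+ n.+1 = 0 ->
  \prod_(0 <= j < n) overpart_series m (x ^+ j.+1) * partial_theta x n = 1.
Proof.
move=> nm x0.
have xm k : (n < k)%N -> x ^+ k = 0.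
  by move=> nk; rewrite -(subnK nk) exprD x0 mulr0.
have Dtheta := partial_theta_prod x n.
rewrite [X in 2 * X]big1_seq ?mulr0 ?addr0 in Dtheta; last first.
  move=> s _; rewrite (xm (s.+1 * n.+1)%N) ?mulr0 ?mul0r //.
  by rewrite mulSn; lia.
have EG : \prod_(0 <= j < n) (1 - x ^+ j.+1)
    * \prod_(0 <= j < n) overpart_series m (x ^+ j.+1)
    = \prod_(0 <= j < n) (1 + x ^+ j.+1).
  rewrite -big_split; apply: eq_bigr => j _ /=.
  by apply: overpart_series_nilp; rewrite -exprM xm // mulSn; lia.
have [z Dz] : exists z, \prod_(0 <= j < n) (1 + x ^+ j.+1) * z = 1.
  elim: {1}n => [|k [z Dz]]; first by exists 1; rewrite big_geq ?mulr1.
  have [|w Dw] := @add1_nilp_inv A n.+1 (x ^+ k.+1).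
    by rewrite -exprM xm // mulSn; lia.
  exists (z * w); rewrite big_nat_recr //= mulrACA Dz mul1r Dw //.
set D := \prod_(_ <= _ < _) (1 + _) in Dtheta EG Dz *.
set E := \prod_(_ <= _ < _) (1 - _) in Dtheta EG *.
set G := \prod_(_ <= _ < _) _ in EG *.
have e : G * partial_theta x n * (D * z) = D * partial_theta x n * G * z by ring.
by rewrite -[LHS]mulr1 -[in LHS]Dz e Dtheta EG.
Qed.

Lemma prod_even_index (A : comNzRingType) (f : nat -> A) n :
  \prod_(0 <= j < n./2) f j.+1.*2 =
  \prod_(0 <= j < n) (if odd j.+1 then 1 else f j.+1).
Proof.
elim: n => [|n IHn]; first by rewrite !big_geq.
rewrite [RHS]big_nat_recr //= -IHn uphalf_half.
case: (boolP (odd n)) => nodd /=; last by rewrite mulr1 add0n.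
by rewrite add1n big_nat_recr // doubleS -[in f n.+1](odd_double_half n) nodd.
Qed.

(** Giving [s.+1] colors to every size overcounts each even size [s] times; the even sizes alone
    form the series in [x ^+ 2], whose inverse is theta at [x ^+ 2]. *)
Lemma prod_colored_series (A : comNzRingType) (x : A) (N s : nat) :
  x ^+ N.+1 = 0 ->
  \prod_(j < N.+1) overpart_series N (x ^+ j) ^+ ncolors s.+1 j =
  (\prod_(0 <= j < N) overpart_series N (x ^+ j.+1)) ^+ s.+1
  * partial_theta (x ^+ 2) N./2 ^+ s.
Proof.
move=> x0.
(* As [2 * N./2.+1] is at least [N.+1], series in [x ^+ 2] may be cut at [N./2]. *)
have x20 : (x ^+ 2) ^+ N./2.+1 = 0.
  rewrite -exprM -(subnK (m := N.+1) (n := (2 * N./2.+1)%N)); last by lia.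
  by rewrite exprD x0 mulr0.
have hN : (N./2 <= N)%N by lia.
have GT := prod_overpart_theta hN x20.
rewrite (_ : \prod_(_ <= _ < _) _ =
  \prod_(0 <= j < N./2) overpart_series N (x ^+ j.+1.*2)) in GT; last first.
  by apply: eq_bigr => j _; rewrite -exprM mul2n.
rewrite (prod_even_index (fun j => overpart_series N (x ^+ j))) in GT.
rewrite -(big_mkord xpredT
  (fun j => overpart_series N (x ^+ j) ^+ ncolors s.+1 j)) big_nat_recl //.
(* Size 0 has no colors, so its factor is an empty power. *)
rewrite {1}/ncolors eqxx expr0 mul1r.
have GTs : (\prod_(0 <= j < N)
    (if odd j.+1 then 1 else overpart_series N (x ^+ j.+1))) ^+ s
    * partial_theta (x ^+ 2) N./2 ^+ s = 1 by rewrite -exprMn GT expr1n.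
move: GTs.
set P := \prod_(_ <= _ < _) (if _ then _ else _).
set F := \prod_(_ <= _ < _) (_ ^+ ncolors _ _).
have -> : (\prod_(0 <= j < N) overpart_series N (x ^+ j.+1)) ^+ s.+1 = F * P ^+ s.
  rewrite -!prodrXl -big_split; apply: eq_bigr => j _; rewrite /ncolors /=.
  by case: (odd j) => /=; rewrite ?expr1n ?mulr1 // -exprD.
by rewrite -mulrA => ->; rewrite mulr1.
Qed.

(** * Reduction modulo 8 and modulo 4 *)

Lemma sqr_sum_mod2 (A : comNzRingType) (f : nat -> A) n :
  8 = 0 :> A ->
  4 * (\sum_(0 <= s < n) f s) ^+ 2 = 4 * \sum_(0 <= s < n) f s ^+ 2.
Proof.
move=> A8; elim: n => [|n IHn]; first by rewrite !big_geq // expr0n.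
rewrite !big_nat_recr //= [RHS]mulrDr -IHn.
set u := \sum_(_ <= _ < _) _.
have -> : 4 * (u + f n) ^+ 2 = 4 * u ^+ 2 + 4 * f n ^+ 2 + 8 * (u * f n) by ring.
by rewrite A8 mul0r addr0.
Qed.

Definition square_sum (A : comNzRingType) (x : A) (n : nat) : A :=
  \sum_(0 <= s < n) x ^+ (s.+1 ^ 2).

Lemma sqr_signed_square_sum (A : comNzRingType) (x : A) n :
  8 = 0 :> A ->
  4 * signed_square_sum x n ^+ 2 = 4 * square_sum (x ^+ 2) n.
Proof.
move=> A8; rewrite sqr_sum_mod2 //; congr (_ * _); apply: eq_bigr => s _.
by rewrite exprMn sqrr_sign mul1r exprAC.
Qed.

(** The square of theta is [1 + 4 (S + S^2)]; in a product of such factors the corrections add up,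
    because their products carry a factor 16. *)
Lemma partial_theta_expX (A : comNzRingType) (x : A) n a :
  8 = 0 :> A -> partial_theta x n ^+ (2 * a) =
  1 + (4 * a)%:R * (signed_square_sum x n + signed_square_sum x n ^+ 2).
Proof.
move=> A8; rewrite /partial_theta.
set S := signed_square_sum x n.
elim: a => [|a IHa]; first by rewrite expr0 mul0r addr0.
rewrite mulnS exprD IHa !natrM -[a.+1%:R]natr1.
have -> : (1 + 2 * S) ^+ 2 * (1 + 4%:R * a%:R * (S + S ^+ 2)) =
  1 + 4%:R * (a%:R + 1) * (S + S ^+ 2)
  + 8 * ((S + S ^+ 2) ^+ 2 * a%:R * 2) by ring.
by rewrite A8 mul0r addr0.
Qed.

Lemma colored_series_even (A : comNzRingType) (x : A) (N a : nat) :
  8 = 0 :> A -> x ^+ N.+1 = 0 -> (0 < a)%N ->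
  let S := signed_square_sum x N + square_sum (x ^+ 2) N in
  let S' := signed_square_sum (x ^+ 2) N./2
            + square_sum (x ^+ 2 ^+ 2) N./2 in
  \prod_(j < N.+1) overpart_series N (x ^+ j) ^+ ncolors (2 * a) j =
  1 + (a%:R * (4 * S) + 2 * signed_square_sum (x ^+ 2) N./2
  + a.-1%:R * (4 * S')).
Proof.
move=> A8 x0; case: a => // a _ S S'.
have -> : (2 * a.+1 = (2 * a).+2)%N by lia.
rewrite prod_colored_series //.
have := prod_overpart_theta (leqnn N) x0.
set G := \prod_(_ <= _ < _) _ => GT.
have T4 : partial_theta x N ^+ 4 = 1.
  rewrite -[4%N]/(2 * 2)%N partial_theta_expX // -[(4 * 2)%N%:R]/(8%:R).
  by rewrite A8 mul0r addr0.
(* [G] is inverse to theta, whose fourth power is 1, so negative even powers of theta become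
   positive ones. *)
have G2 : G ^+ 2 = partial_theta x N ^+ 2.
  rewrite -[LHS]mulr1 -T4 -[4%N]/(2 + 2)%N exprD mulrA -exprMn GT.
  by rewrite expr1n mul1r.
rewrite (_ : (2 * a).+2 = 2 * a.+1)%N; last by lia.
rewrite exprM G2 -exprM exprS !partial_theta_expX // mulrDr.
(* Turning each [square_sum] back into a square makes both sides polynomials in two signed sums,
   which differ by an explicit multiple of 8. *)
rewrite {}/S {}/S' !(mulrDr 4) -!sqr_signed_square_sum //.
rewrite /partial_theta !natrM /=.
set S := signed_square_sum x N; set S' := signed_square_sum _ _.
pose B := S + S ^+ 2; pose B' := S' + S' ^+ 2.
set L := (X in X = _); set r := (X in _ = X).
have -> : L = r + 8 * (a.+1%:R * B * S' + a%:R * B' * S'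
    + 2 * a%:R * a.+1%:R * B * B' * (1 + 2 * S')) by rewrite /L /r /B /B'; ring.
by rewrite A8 mul0r addr0.
Qed.

(** Modulo 4 theta squares to 1, so it is its own inverse and all its even powers disappear. *)
Lemma colored_series_odd (A : comNzRingType) (x : A) (N b : nat) :
  4 = 0 :> A -> x ^+ N.+1 = 0 ->
  \prod_(j < N.+1) overpart_series N (x ^+ j) ^+ ncolors (2 * b + 1) j =
  1 + 2 * signed_square_sum x N.
Proof.
move=> A4 x0.
have theta2 y n : partial_theta y n ^+ 2 = 1 :> A.
  rewrite /partial_theta; set S := signed_square_sum _ _.
  have -> : (1 + 2 * S) ^+ 2 = 1 + 4 * (S + S ^+ 2) by ring.
  by rewrite A4 mul0r addr0.
rewrite addn1 prod_colored_series // exprM theta2 expr1n mulr1.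
have := prod_overpart_theta (leqnn N) x0.
set G := \prod_(_ <= _ < _) _ => GT.
have -> : G = partial_theta x N.
  by rewrite -[LHS]mulr1 -(theta2 x N) expr2 mulrA GT mul1r.
by rewrite exprS exprM theta2 expr1n mulr1.
Qed.

(** * From counting overpartitions to coefficients *)

Lemma coef_in_qpolyXn (R : comNzRingType) (N : nat) (p : {poly R}) :
  (in_qpoly 'X^(N.+1) p : {poly R})`_N = p`_N.
Proof.
rewrite /in_qpoly /= mk_monic_Xn.
rewrite [in RHS](Pdiv.RingMonic.rdivp_eq (monicXn R N.+1) p).
by rewrite coefD coefMXn ltnSn add0r.
Qed.

(** The admissible overlinings are the subsets of the support of [m]. *)
Lemma card_overlined (s N : nat) (m : {ffun cpart s N -> 'I_N.+1}) :
  #|[set O : {set cpart s N} | [forall u in O, 0 < m u]%N]| =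
  (\prod_u 2 ^ (0 < m u))%N.
Proof.
rewrite -expn_sum -big_mkcond /= sum1_card -[#|_|]cardsE -card_powerset.
apply: eq_card => O; rewrite !inE.
apply/forallP/subsetP => [mO u uO | Om u].
  by rewrite inE; exact: (implyP (mO u)).
by apply/implyP => /Om; rewrite inE.
Qed.

(** Expanding the product means choosing an exponent for each colored part, that is a multiplicity
    function [m]; its weight counts the overlinings of [m]. *)
Lemma abar_coef (R : comNzRingType) (s N : nat) :
  (abar s N)%:R =
  (\prod_(j < N.+1) overpart_series N ('X ^+ j : {poly R}) ^+ ncolors s j)`_N.
Proof.
under eq_bigr => j _ do
  rewrite -[X in _ ^+ X]card_ord -prodr_const.
(* Sizes and colors merge into one index of type [cpart s N]. *)
rewrite (sig_big_dep (J := fun j : 'I_N.+1 => 'I_(ncolors s j)) xpredT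
  (fun _ => xpredT) (fun j _ => overpart_series N ('X ^+ j))) /=.
rewrite bigA_distr_bigA coef_sum.
rewrite /abar -sum1_card.
under eq_bigl => mO do rewrite inE.
rewrite -(pair_big_dep xpredT (fun m O => is_overpartition m O)
  (fun _ _ => 1%N)) /= natr_sum; apply: eq_bigr => m _.
under [in RHS]eq_bigr => u _ do rewrite -exprM.
rewrite big_split /= -natr_prod -card_overlined prodrXr.
rewrite mulr_natl coefMn coefXn -mulrnA sum1_card; congr (_%:R).
have -> : (\sum_(u : cpart s N) tag u * m u)%N =
    (\sum_(u : cpart s N) m u * part_size u)%N.
  by apply: eq_bigr => u _; rewrite mulnC.
rewrite eq_sym /is_overpartition; case: eqP => _; last first.
  by apply: eq_card0.
by rewrite mul1n -[RHS]cardsE; apply: eq_card => O; rewrite !inE.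
Qed.

Lemma rmorph_overpart_series (A B : comNzRingType) (f : {rmorphism A -> B}) m y :
  f (overpart_series m y) = overpart_series m (f y).
Proof.
rewrite rmorph_sum; apply: eq_bigr => i _.
by rewrite rmorphM rmorph_nat rmorphXn.
Qed.

Lemma rmorph_signed_square_sum (A B : comNzRingType) (f : {rmorphism A -> B}) y n :
  f (signed_square_sum y n) = signed_square_sum (f y) n.
Proof.
rewrite rmorph_sum; apply: eq_bigr => i _.
by rewrite rmorphM rmorph_sign rmorphXn.
Qed.

Lemma rmorph_square_sum (A B : comNzRingType) (f : {rmorphism A -> B}) y n :
  f (square_sum y n) = square_sum (f y) n.
Proof. by rewrite rmorph_sum; apply: eq_bigr => i _; rewrite rmorphXn. Qed.

Lemma coef_sum_squares (R : comNzRingType) (c : nat -> R) (d n N : nat) :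
  (forall t, N <> d * t ^ 2)%N ->
  (\sum_(0 <= s < n) (c s)%:P * ('X ^+ d) ^+ (s.+1 ^ 2))`_N = 0.
Proof.
move=> Nd; rewrite coef_sum big1 // => s _.
rewrite -exprM coefCM coefXn; case: eqP => [/Nd|] //.
by rewrite mulr0.
Qed.

Lemma coef_signed_square_sum (R : comNzRingType) (d n N : nat) :
  (forall t, N <> d * t ^ 2)%N -> (signed_square_sum ('X ^+ d : {poly R}) n)`_N = 0.
Proof.
move=> Nd; rewrite -[RHS](coef_sum_squares (fun s => (-1) ^+ s.+1) n Nd).
congr (polyseq _)`_N; apply: eq_bigr => s _.
by rewrite rmorph_sign.
Qed.

Lemma coef_square_sum (R : comNzRingType) (d n N : nat) :
  (forall t, N <> d * t ^ 2)%N ->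
  (square_sum ('X ^+ d : {poly R}) n)`_N = 0.
Proof.
move=> Nd; rewrite -[RHS](coef_sum_squares (fun=> 1) n Nd).
by congr (polyseq _)`_N; apply: eq_bigr => s _; rewrite mul1r.
Qed.

Lemma in_qpolyXn_nilp (R : comNzRingType) (N : nat) :
  in_qpoly ('X^(N.+1) : {poly R}) 'X ^+ N.+1 = 0.
Proof.
rewrite -rmorphXn; apply/val_inj.
by rewrite /= mk_monic_Xn Pdiv.RingMonic.rmodpp ?monicXn.
Qed.

(** Reduction modulo ['X^(N.+1)] keeps the coefficient of degree [N], so identities proved for
    nilpotent [x] determine [abar]. *)
Lemma abar_in_qpoly (R : comNzRingType) (s N : nat) (p : {poly R}) :
  (let x := in_qpoly 'X^(N.+1) ('X : {poly R}) in
   \prod_(j < N.+1) overpart_series N (x ^+ j) ^+ ncolors s j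
     = in_qpoly 'X^(N.+1) p) ->
  (abar s N)%:R = p`_N.
Proof.
move=> /= e; rewrite abar_coef -[LHS]coef_in_qpolyXn -[RHS]coef_in_qpolyXn -e.
congr (polyseq (val _))`_N; rewrite rmorph_prod; apply: eq_bigr => j _.
by rewrite rmorphXn rmorph_overpart_series rmorphXn.
Qed.

Lemma natr_Zp_eq0 (m n : nat) : (1 < m)%N -> n%:R = 0 :> 'Z_m -> (m %| n)%N.
Proof. by move=> m1 /(congr1 val); rewrite /= val_Zp_nat // => /eqP. Qed.

(** The series over ['Z_8] only has exponents 0, [t^2], [2 t^2] and [4 t^2]; the last kind is again
    a square. *)
Lemma abar_even_mod8 (a N : nat) : (0 < a)%N -> (0 < N)%N ->
  (forall t, N <> t ^ 2)%N -> (forall t, N <> 2 * t ^ 2)%N ->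
  (8 %| abar (2 * a) N)%N.
Proof.
move=> a0 N0 N1 N2.
have N4 t : (N <> 4 * t ^ 2)%N.
  by have := N1 (2 * t)%N; rewrite expnMn.
pose R := [the comNzRingType of 'Z_8].
have R8 : 8%:R = 0 :> R by apply/val_inj.
pose X : {poly R} := 'X.
pose S := signed_square_sum X N + square_sum (X ^+ 2) N.
pose S' := signed_square_sum (X ^+ 2) N./2
  + square_sum (X ^+ 2 ^+ 2) N./2.
pose p := 1 + (a%:R * (4%:R * S) + 2%:R * signed_square_sum (X ^+ 2) N./2
  + a.-1%:R * (4%:R * S')).
have e : (abar (2 * a) N)%:R = p`_N :> R.
  apply: abar_in_qpoly => x.
  rewrite colored_series_even ?in_qpolyXn_nilp //; last first.
    by rewrite -(rmorph_nat (in_qpoly _)) -(rmorph_nat polyC) R8 !rmorph0.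
  rewrite /p /S /S'.
  rewrite !(rmorph_nat, rmorph1, rmorph_signed_square_sum, rmorph_square_sum,
            rmorphXn, rmorphD, rmorphM).
  by [].
have e0 : p`_N = 0.
  rewrite /p /S /S' !mulr_natl -!exprM.
  rewrite !(coefD, coefMn) -[X in signed_square_sum X N]expr1.
  rewrite !coef_signed_square_sum ?coef_square_sum //; last first.
    by move=> t; rewrite mul1n.
  by rewrite coef1 -[N]prednK // !(addr0, mul0rn).
by apply: natr_Zp_eq0; rewrite // e e0.
Qed.

Lemma abar_odd_mod4 (b N : nat) : (0 < N)%N -> (forall t, N <> t ^ 2)%N ->
  (4 %| abar (2 * b + 1) N)%N.
Proof.
move=> N0 N1.
pose R := [the comNzRingType of 'Z_4].
have R4 : 4%:R = 0 :> R by apply/val_inj.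
pose X : {poly R} := 'X.
pose p := 1 + 2%:R * signed_square_sum X N.
have e : (abar (2 * b + 1) N)%:R = p`_N :> R.
  apply: abar_in_qpoly => x.
  rewrite colored_series_odd ?in_qpolyXn_nilp //; last first.
    by rewrite -(rmorph_nat (in_qpoly _)) -(rmorph_nat polyC) R4 !rmorph0.
  by rewrite !(rmorph_nat, rmorph1, rmorph_signed_square_sum, rmorphD, rmorphM).
have e0 : p`_N = 0.
  rewrite /p !mulr_natl !(coefD, coefMn) -[X in signed_square_sum X N]expr1.
  rewrite coef_signed_square_sum; last by move=> t; rewrite mul1n.
  by rewrite coef1 -[N]prednK // !(addr0, mul0rn).
by apply: natr_Zp_eq0; rewrite // e e0.
Qed.

End OverpartitionSeries.

(** * Valuations of the exponents *)

(** The valuation of [d * t ^ 2] at [p] is twice that of [t]. *)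
Lemma odd_logn_not_mul_square (p d N t : nat) :
  coprime p d -> 0 < N -> odd (logn p N) -> N <> d * t ^ 2.
Proof.
move=> pd N0 oddN NE; move: oddN N0; rewrite {}NE muln_gt0 => oddN /andP[d0 t0].
by move: oddN; rewrite lognM // lognX logn_coprime // mul2n odd_double.
Qed.

Theorem theorem1p9 (p alpha beta : nat) (hp : prime p) (hp3 : 3 <= p)
    (halpha : 1 <= alpha) (hbeta : 1 <= beta) :
  (abar (2 * alpha) (4 * p) = 0 %[mod 2] ->
   forall n k : nat, ~~ (p %| 2 * n + 1) ->
     abar (2 * alpha) (8 * p ^ (2 * k + 1) * n + 4 * p ^ (2 * k + 1))
       = 0 %[mod 8])
  /\
  (abar (2 * beta + 1) (4 * p) = 0 %[mod 2] ->
   forall n k : nat, ~~ (p %| 2 * n + 1) ->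
     abar (2 * beta + 1) (8 * p ^ (2 * k + 1) * n + 4 * p ^ (2 * k + 1))
       = 0 %[mod 4]).
Proof.
have cop2 : coprime p 2.
  by rewrite prime_coprime // dvdn_prime2 //; apply/eqP => p2; rewrite p2 in hp3.
suff argN n k : ~~ (p %| 2 * n + 1) ->
    let N := 8 * p ^ (2 * k + 1) * n + 4 * p ^ (2 * k + 1) in
    0 < N /\ odd (logn p N).
  split=> _ n k pn; have [N0 oddN] := argN n k pn; rewrite mod0n; apply/eqP.
    apply: abar_even_mod8 => // t; last exact: odd_logn_not_mul_square oddN.
    by rewrite -[t ^ 2]mul1n; apply: odd_logn_not_mul_square oddN; rewrite ?coprimen1.
  apply: abar_odd_mod4 => // t.
  by rewrite -[t ^ 2]mul1n; apply: odd_logn_not_mul_square oddN; rewrite ?coprimen1.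
move=> pn N.
(* The outer factors are prime to [p], so the valuation is [2 * k + 1]. *)
have -> : N = 2 ^ 2 * (p ^ (2 * k + 1) * (2 * n + 1)) by rewrite /N; lia.
have q0 : 0 < p ^ (2 * k + 1) by rewrite expn_gt0 prime_gt0.
have n0 : 0 < 2 * n + 1 by rewrite addn1.
split; first by rewrite !muln_gt0 q0 n0.
rewrite !lognM ?muln_gt0 ?q0 ?n0 // !lognX (logn_coprime cop2).
rewrite logn_prime // eqxx (@logn_coprime _ (2 * n + 1)) ?prime_coprime //.
by rewrite !add0n addn0 muln1 addn1 mul2n /= odd_double.
Qed.
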